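(* Let $Z,Y$ be Asplund spaces, $f:Z\to Y$ locally Lipschitz, $K\subset Y$ a pointed closed convex cone, $\mathcal{U}$ a sequentially compact topological space, and $g=(g_1,\dots,g_n)$ with $g_i:Z\times\mathcal{U}\to\mathbb{R}$. Assume that $\bar z\in F$ satisfies the robust (KKT) condition. (i) If $(f,g)$ is type I pseudo convex at $\bar z$, then $\bar z\in\mathcal{S}^w(RP)$ (i.e. $\bar z$ is a weakly robust efficient solution). (ii) If $(f,g)$ is type II pseudo convex at $\bar z$, then $\bar z\in\mathcal{S}(RP)$ (i.e. $\bar z$ is a robust efficient solution).
   Context: Notation. $Z^*,Y^*$ are the topological duals; $\mathrm{cl}^*$ is weak$^*$ closure, $\mathrm{co}$ convex hull, $\mathrm{int}$ topological interior. $K$ pointed means $K\cap(-K)=\{0\}$. The dual cone is $K^+=\{y^*\in Y^*\mid \langle y^*,y\rangle\ge 0\ \forall y\in K\}$. $\langle y^*,f\rangle(z):=\langle y^*,f(z)\rangle$. $\mathbb{R}^n_+$ is the nonnegative orthant. Robust problem. The feasible set is $F=\{z\in Z\mid g_i(z,u)\le 0\ \forall u\in\mathcal{U},\ i=1,\dots,n\}$. $\bar z\in\mathcal{S}(RP)$ means $\bar z\in F$ and $f(z)-f(\bar z)\notin-K\setminus\{0\}$ for all $z\in F$. $\bar z\in\mathcal{S}^w(RP)$ means $\bar z\in F$ and $f(z)-f(\bar z)\notin-\mathrm{int}\,K$ for all $z\in F$. $\mathcal{U}_i(z):=\{u\in\mathcal{U}\mid g_i(z,u)=\max_{u'\in\mathcal{U}}g_i(z,u')\}$.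 Robust (KKT) condition. $\bar z\in F$ satisfies it if there exist $y^*\in K^+\setminus\{0\}$, $\mu=(\mu_1,\dots,\mu_n)\in\mathbb{R}^n_+$ and $\bar u_i\in\mathcal{U}$, $i=1,\dots,n$, such that $0\in\partial\langle y^*,f\rangle(\bar z)+\sum_{i=1}^n\mu_i\,\mathrm{cl}^*\mathrm{co}\big(\bigcup\{\partial_z g_i(\bar z,u)\mid u\in\mathcal{U}_i(\bar z)\}\big)$ and $\mu_i\max_{u\in\mathcal{U}}g_i(\bar z,u)=\mu_i g_i(\bar z,\bar u_i)=0$ for $i=1,\dots,n$. Generalized convexity. - $f$ is pseudo convex at $\bar z$ if for all $z\in Z$, $y^*\in K^+$: $\langle y^*,f\rangle(z)<\langle y^*,f\rangle(\bar z)$ implies $\langle v^*,z-\bar z\rangle<0$ for all $v^*\in\partial\langle y^*,f\rangle(\bar z)$. - $f$ is strictly pseudo convex at $\bar z$ if for all $z\in Z\setminus\{\bar z\}$, $y^*\in K^+\setminus\{0\}$: $\langle y^*,f\rangle(z)\le\langle y^*,f\rangle(\bar z)$ implies $\langle v^*,z-\bar z\rangle<0$ for all $v^*\in\partial\langle y^*,f\rangle(\bar z)$. - $g$ is generalized quasi convex at $\bar z$ if for all $z\in Z$, $u\in\mathcal{U}$ and $i=1,\dots,n$: $g_i(z,u)\le g_i(\bar z,u)$ implies $\langle u_i^*,z-\bar z\rangle\le 0$ for all $u_i^*\in\partial_z g_i(\bar z,u)$. - $(f,g)$ is type I (resp. type II) pseudo convex at $\bar z$ if $f$ is pseudo convex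 (resp. strictly pseudo convex) and $g$ is generalized quasi convex at $\bar z$. Subdifferential. For $\Gamma$ locally closed around $\bar x\in\Gamma$: the Fréchet normal cone is $\widehat N(\bar x;\Gamma)=\{x^*\mid\limsup_{x\to\bar x,\,x\in\Gamma}\langle x^*,x-\bar x\rangle/\|x-\bar x\|\le 0\}$, and the Mordukhovich normal cone $N(\bar x;\Gamma)$ is the set of $x^*$ for which there are sequences $x_k\to\bar x$, $x_k\in\Gamma$, and $x_k^*\in\widehat N(x_k;\Gamma)$ with $x_k^*\to x^*$ weak$^*$. The limiting (Mordukhovich) subdifferential of $\varphi:Z\to\overline{\mathbb{R}}$ at $\bar z$ with $\varphi(\bar z)$ finite is $\partial\varphi(\bar z)=\{z^*\in Z^*\mid(z^*,-1)\in N((\bar z,\varphi(\bar z));\mathrm{epi}\,\varphi)\}$. $\partial_z g_i(z,u)$ is the limiting subdifferential of $g_i(\cdot,u)$ at $z$. *)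

(* Defs.v *)
From HB Require Import structures.
From mathcomp Require Export all_boot all_order all_algebra.
From mathcomp Require Export all_classical all_reals all_analysis.

Set Implicit Arguments.
Unset Strict Implicit.
Unset Printing Implicit Defensive.

Export Order.TTheory GRing.Theory Num.Theory.
Export numFieldNormedType.Exports.

Local Open Scope classical_set_scope.
Local Open Scope ring_scope.

Section Dual.
Variables (R : realType) (V : normedModType R).

Definition dual_pred : {pred V -> R^o} :=
  fun f => `[< linear f /\ continuous f >].

Record dual :=
  Dual { dual_fun :> V -> R^o ; dual_funP : dual_fun \in dual_pred }.

HB.instance Definition _ := [isSub for dual_fun].
HB.instance Definition _ := [Choice of dual by <:].

Lemma dual_submod_closed : submod_closed dual_pred.
Proof.
split=> [|a f g].
  apply/asboolP; split=> [b x y|x]; first by rewrite scaler0 addr0.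
  exact: cst_continuous.
move=> /asboolP[lf cf] /asboolP[lg cg]; apply/asboolP; split.
  move=> b x y; have E z : (a *: f + g) z = a *: f z + g z by [].
  rewrite !E lf lg !scalerDr !scalerA (mulrC a) -!addrA; congr (_ + _).
  by rewrite addrCA.
move=> x; apply: (@cvgD _ R^o); last exact: cg.
by apply: (@cvgZl_tmp _ R^o); exact: cf.
Qed.

HB.instance Definition _ :=
  GRing.isSubmodClosed.Build R (V -> R^o) dual_pred dual_submod_closed.
HB.instance Definition _ := [SubChoice_isSubLmodule of dual by <:].

Lemma dual_linear (f : dual) : linear f.
Proof. by have /asboolP[] := dual_funP f. Qed.

HB.instance Definition _ (f : dual) :=
  GRing.isLinear.Build R V R^o *:%R f (dual_linear f).

Lemma dual_continuous (f : dual) : continuous f.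
Proof. by have /asboolP[] := dual_funP f. Qed.

(* [dual] carries the weak* topology, so that [closure] and [-->] on it are the
   weak* ones; the norm topology of the dual is never used. *)
HB.instance Definition _ := Topological.copy dual
  (initial_topology (dual_fun : dual -> {ptws V -> R^o})).

End Dual.

Section DualPair.
Variables (R : realType) (V : normedModType R).

Lemma dual_pair_subproof (xs : dual V) (c : R) :
  (fun p : V * R^o => xs p.1 + c * p.2 : R^o) \in @dual_pred R (V * R^o)%type.
Proof.
apply/asboolP; split=> [b [x r] [y s]|[x r]] /=.
  by rewrite linearP /GRing.scale /= !mulrDr mulrCA addrACA.
apply: (@cvgD _ R^o).
  by apply: continuous_comp; [exact: cvg_fst|exact: dual_continuous].
by apply: (@cvgZl_tmp _ R^o); exact: cvg_snd.
Qed.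

(* The element (x*, c) of (V x R)*, identified with V* x R. *)
Definition dual_pair (xs : dual V) (c : R) : dual (V * R^o)%type :=
  Dual (dual_pair_subproof xs c).

End DualPair.

(* [differentiable] is Frechet differentiability; D is open, so [continuous] at
   the points of D is continuity of the restriction of phi to D. *)
Definition asplund (R : realType) (X : completeNormedModType R) : Prop :=
  forall (D : set X) (phi : X -> R^o),
    open D -> convex_set D ->
    convex_function D phi -> {in D, continuous phi} ->
    D `<=` closure [set x | D x /\ differentiable phi x].

Definition locally_lipschitz (R : realType) (V W : normedModType R)
    (f : V -> W) : Prop :=
  forall x : V, exists2 A, nbhs x A & [lipschitz f z | z in A].

Section Subdifferential.
Variables (R : realType).

(* The limsup along the punctured trace of nbhs x on Gamma: it is -oo when x is
   isolated in Gamma. *)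
Definition frechet_normal (V : normedModType R) (Gamma : set V) (x : V) :
    set (dual V) :=
  [set xs | (limf_esup (fun y => (xs (y - x) / `|y - x|)%:E)
                       (within Gamma x^') <= 0)%E].

Definition limiting_normal (V : normedModType R) (Gamma : set V) (x : V) :
    set (dual V) :=
  [set xs | exists (x_ : nat -> V) (xs_ : nat -> dual V),
    [/\ x_ @ \oo --> x,
        forall k, Gamma (x_ k),
        forall k, frechet_normal Gamma (x_ k) (xs_ k)
      & xs_ @ \oo --> xs]].

(* V x R carries the max norm; the cones depend only on the norm's equivalence
   class. *)
Definition epigraph (V : normedModType R) (phi : V -> \bar R) :
    set (V * R^o)%type :=
  [set p | (phi p.1 <= (p.2 : R)%:E)%E].

Definition limiting_subdiff (V : normedModType R) (phi : V -> \bar R) (z : V) :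
    set (dual V) :=
  [set zs | phi z \is a fin_num /\
    limiting_normal (epigraph phi) (z, fine (phi z) : R^o) (dual_pair zs (-1))].

End Subdifferential.

Definition oppset (V : zmodType) (A : set V) : set V := [set - x | x in A].

Definition is_cone (R : realType) (V : lmodType R) (K : set V) : Prop :=
  forall (t : R) x, 0 <= t -> K x -> K (t *: x).

Definition pointed (V : zmodType) (K : set V) : Prop :=
  K `&` oppset K = [set 0].

Definition dual_cone (R : realType) (V : normedModType R) (K : set V) :
    set (dual V) :=
  [set ys | forall y, K y -> 0 <= ys y].

Definition convex_hull (R : realType) (V : lmodType R) (A : set V) : set V :=
  smallest (@convex_set R V) A.

Definition seq_compact (T : topologicalType) : Prop :=
  forall u : nat -> T, exists2 phi : nat -> nat,
    {homo phi : m n / (m < n)%N} & exists l : T, (u \o phi) @ \oo --> l.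

Definition is_max (R : realType) (A : set R) (M : R) : Prop :=
  A M /\ ubound A M.

Section RobustProblem.
Variables (R : realType) (Z Y : normedModType R) (U : topologicalType).
Variables (n : nat) (f : Z -> Y) (K : set Y) (g : 'I_n -> Z -> U -> R).
Variable zbar : Z.

Definition feasible : set Z := [set z | forall i u, g i z u <= 0].

Definition robust_efficient : Prop :=
  feasible zbar /\
  forall z, feasible z -> ~ (oppset K `\ 0) (f z - f zbar).

Definition weakly_robust_efficient : Prop :=
  feasible zbar /\
  forall z, feasible z -> ~ oppset (interior K) (f z - f zbar).

Definition active (i : 'I_n) (z : Z) : set U :=
  [set u | is_max (range (g i z)) (g i z u)].

Definition subdiff_f (ys : dual Y) (z : Z) : set (dual Z) :=
  limiting_subdiff (fun x => (ys (f x) : R)%:E) z.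

Definition subdiff_g (i : 'I_n) (z : Z) (u : U) : set (dual Z) :=
  limiting_subdiff (fun x => (g i x u)%:E) z.

Definition active_subdiff (i : 'I_n) : set (dual Z) :=
  closure (convex_hull (\bigcup_(u in active i zbar) subdiff_g i zbar u)).

Definition robust_KKT : Prop :=
  feasible zbar /\
  exists (ys : dual Y) (mu : 'rV[R]_n) (ubar : 'I_n -> U),
    [/\ (dual_cone K `\ 0) ys,
        forall i, 0 <= mu 0 i,
        [set v + \sum_(i < n) mu 0 i *: w i
          | v in subdiff_f ys zbar
          & w in [set w | forall i, active_subdiff i (w i)]] 0
      & forall i, exists M : R,
          [/\ is_max (range (g i zbar)) M,
              mu 0 i * M = mu 0 i * g i zbar (ubar i)
            & mu 0 i * g i zbar (ubar i) = 0]].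

Definition pseudo_convex : Prop :=
  forall (z : Z) (ys : dual Y), dual_cone K ys ->
    ys (f z) < ys (f zbar) :> R ->
    forall vs, subdiff_f ys zbar vs -> vs (z - zbar) < 0 :> R.

Definition strictly_pseudo_convex : Prop :=
  forall (z : Z) (ys : dual Y), z <> zbar -> (dual_cone K `\ 0) ys ->
    ys (f z) <= ys (f zbar) :> R ->
    forall vs, subdiff_f ys zbar vs -> vs (z - zbar) < 0 :> R.

Definition generalized_quasi_convex : Prop :=
  forall (z : Z) (u : U) (i : 'I_n), g i z u <= g i zbar u ->
    forall us, subdiff_g i zbar u us -> us (z - zbar) <= 0 :> R.

Definition type1_pseudo_convex : Prop :=
  pseudo_convex /\ generalized_quasi_convex.

Definition type2_pseudo_convex : Prop :=
  strictly_pseudo_convex /\ generalized_quasi_convex.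

End RobustProblem.

(* Main.v *)
Require Import Defs.

Local Open Scope classical_set_scope.
Local Open Scope ring_scope.

(** The robust KKT condition writes 0 as v* + sum_i mu_i w_i*, with v* a
    subgradient of <y*, f> at zbar and w_i* in the weak* closed convex hull of
    the subgradients of the constraints g_i(., u) active at zbar. The whole
    argument is to evaluate this identity at h = z - zbar, for z feasible.

    If mu_i > 0, complementary slackness says that the worst-case value of g_i
    at zbar is 0, so that g_i(z, u) <= 0 = g_i(zbar, u) for every active u;
    generalized quasi convexity then places every active subgradient in
    [set w | w h <= 0]. This half-space is convex and weak* closed, because
    evaluation at h is linear and weak* continuous, hence it contains w_i* too
    ([active_subdiff_le0]). Therefore v* h >= 0 ([robust_KKT_ge0]).

    Since v* h >= 0, pseudo convexity gives <y*, f>(z) >= <y*, f>(zbar), and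
    strict pseudo convexity gives <y*, f>(z) > <y*, f>(zbar) as soon as
    z <> zbar. A feasible z dominating zbar contradicts this: f z - f zbar in
    -K \ {0} forces z <> zbar and <y*, f z - f zbar> <= 0, while f z - f zbar in
    -int K makes this inequality strict, because a nonzero element of K^+ is
    positive on the interior of K ([dual_cone_interior_gt0]). *)

Section WeakStar.
Set Implicit Arguments.
Unset Strict Implicit.

Variables (R : realType) (V : normedModType R).

Lemma dual_sum_scaleE (I : finType) (v : dual V) (c : I -> R)
    (w : I -> dual V) (h : V) :
  (v + \sum_i c i *: w i) h = v h + \sum_i c i * w i h :> R.
Proof.
have evalD (a b : dual V) : (a + b) h = a h + b h by [].
rewrite evalD; congr (_ + _).
by elim/big_rec2 : _ => // i y1 y2 _ <-.
Qed.

(** The weak* topology is the one induced by pointwise convergence, for which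
    evaluation at h is a coordinate projection. *)
Lemma dual_eval_continuous (h : V) : continuous (fun w : dual V => w h : R^o).
Proof.
move=> w; apply: (@continuous_comp _ {ptws V -> R^o} _ (@dual_fun R V)
  (fun p : {ptws V -> R^o} => p h)).
  exact: initial_continuous.
exact: (@proj_continuous V (fun=> R^o) h).
Qed.

Lemma halfspace_closed (h : V) : closed [set w : dual V | w h <= 0 :> R].
Proof.
apply: (@preimage_closed _ _ (fun w : dual V => w h : R^o)
  [set r : R^o | r <= 0 :> R]); last exact: closed_le.
by move=> w _; exact: dual_eval_continuous.
Qed.

Lemma halfspace_convex (h : V) :
  convex_set [set w : dual V | w h <= 0 :> R].
Proof.
move=> a b t; rewrite !inE /= => ah bh.
suff: t%:num * a h + (1 - t%:num) * b h <= 0 :> R by [].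
by rewrite -oppr_ge0 opprD addr_ge0// -mulrN mulr_ge0 ?oppr_ge0// subr_ge0.
Qed.

Lemma closure_convex_hull_le0 (A : set (dual V)) (h : V) :
  (forall w, A w -> w h <= 0 :> R) ->
  forall w, closure (convex_hull A) w -> w h <= 0 :> R.
Proof.
move=> Ah w; rewrite closureE.
apply: (@smallest_sub _ _ _ [set w : dual V | w h <= 0 :> R]).
  exact: halfspace_closed.
apply: (@smallest_sub _ _ _ [set w : dual V | w h <= 0 :> R]) => //.
exact: halfspace_convex.
Qed.

(** Moving from k a little in the direction - (ys y) *: y stays in K and, when
    ys y != 0, strictly decreases ys, whose value there is still >= 0. *)
Lemma dual_cone_interior_gt0 (K : set V) (ys : dual V) (k : V) :
  (dual_cone K `\ 0) ys -> interior K k -> 0 < ys k :> R.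
Proof.
move=> [Kys ys0] Kk.
have [y ysy] : exists y, ys y != 0 :> R.
  apply: contra_notP ys0 => /forallNP ys0.
  by apply/val_inj/funext => y /=; apply/eqP/negP => /negP /ys0.
pose path (t : R) : V := k - (t * ys y) *: y.
have : path @ 0^'+ --> k.
  apply: cvg_at_right_filter.
  rewrite -[X in _ --> X]subr0 -[X in _ --> _ - X](scale0r y).
  apply: cvgB; first exact: cvg_cst.
  apply: cvgZr_tmp; rewrite -[X in _ --> X](mul0r (ys y)).
  by apply: cvgMr_tmp; exact: cvg_id.
move=> /(_ _ Kk) /= Kpath.
near (0 : R)^'+ => t.
have t0 : 0 < t by near: t; exact: nbhs_right_gt.
have /Kys : K (path t) by near: t.
have -> : ys (path t) = ys k - t * ys y ^+ 2 :> R.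
  by rewrite /path linearB linearZ /= /GRing.scale /= -mulrA.
by rewrite subr_ge0; apply: lt_le_trans; rewrite mulr_gt0// exprn_even_gt0.
Unshelve. all: by end_near. Qed.

End WeakStar.

Section RobustKKT.
Set Implicit Arguments.
Unset Strict Implicit.

Variables (R : realType) (Z Y : normedModType R) (U : topologicalType).
Variables (n : nat) (f : Z -> Y) (K : set Y) (g : 'I_n -> Z -> U -> R).
Variable zbar : Z.

Lemma is_max_unique (A : set R) (M M' : R) :
  is_max A M -> is_max A M' -> M = M'.
Proof.
by move=> [AM uM] [AM' uM']; apply/eqP; rewrite eq_le uM//= uM'.
Qed.

(** At an active u the constraint takes its worst-case value 0, so a feasible z
    satisfies g_i(z, u) <= g_i(zbar, u), which triggers quasi convexity. *)
Lemma active_subdiff_le0 (i : 'I_n) (z : Z) :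
  generalized_quasi_convex g zbar -> feasible g z ->
  is_max (range (g i zbar)) 0 ->
  forall w, active_subdiff g zbar i w -> w (z - zbar) <= 0 :> R.
Proof.
move=> gqc Fz max0; apply: closure_convex_hull_le0 => w [u actu].
by apply: gqc; rewrite (is_max_unique actu max0); exact: Fz.
Qed.

(** What the KKT condition contributes to both parts: evaluated at z - zbar, the
    constraint terms with mu_i = 0 vanish and the others are <= 0, which leaves
    the subgradient of the objective nonnegative. *)
Lemma robust_KKT_ge0 :
  generalized_quasi_convex g zbar -> robust_KKT f K g zbar ->
  exists2 ys : dual Y, (dual_cone K `\ 0) ys &
    exists2 v, subdiff_f f ys zbar v &
      forall z, feasible g z -> 0 <= v (z - zbar) :> R.
Proof.
move=> gqc [_ [ys [mu [ubar [Kys mu0 [v fv [w gw vw0]] slack]]]]].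
exists ys => //; exists v => // z Fz.
have : v (z - zbar) + \sum_i mu 0 i * w i (z - zbar) = 0 :> R.
  by rewrite -dual_sum_scaleE vw0.
move/eqP; rewrite addr_eq0 => /eqP ->; rewrite oppr_ge0.
apply: sumr_le0 => i _.
have [->|mui] := eqVneq (mu 0 i) 0; first by rewrite mul0r.
apply: mulr_ge0_le0 => //; apply: (active_subdiff_le0 gqc Fz _ (gw i)).
have [M [maxM muM slack_i]] := slack i.
have /eqP : mu 0 i * M = 0 by rewrite muM.
by rewrite mulf_eq0 (negbTE mui) => /eqP <-.
Qed.

End RobustKKT.

Theorem theorem3p4 (R : realType) (Z Y : completeNormedModType R)
    (U : topologicalType) (n : nat) (f : Z -> Y) (K : set Y)
    (g : 'I_n -> Z -> U -> R) (zbar : Z)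
    (asplundZ : asplund Z) (asplundY : asplund Y)
    (lipf : locally_lipschitz f)
    (pointedK : pointed K) (closedK : closed K)
    (convexK : convex_set K) (coneK : is_cone K)
    (compactU : seq_compact U)
    (zbarF : feasible g zbar) (kkt : robust_KKT f K g zbar) :
  (type1_pseudo_convex f K g zbar -> weakly_robust_efficient f K g zbar) /\
  (type2_pseudo_convex f K g zbar -> robust_efficient f K g zbar).
Proof.
split=> -[fconvex gqc]; split=> // z Fz.
- have [ys Kys [v fv v_ge0]] := robust_KKT_ge0 gqc kkt.
  move=> [k Kk fzk].
  suff : v (z - zbar) < 0 :> R by rewrite ltNge v_ge0.
  apply: fconvex fv; first by case: Kys.
  rewrite -subr_lt0 -linearB -fzk linearN oppr_lt0.
  exact: (dual_cone_interior_gt0 Kys).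
- have [ys Kys [v fv v_ge0]] := robust_KKT_ge0 gqc kkt.
  move=> [[k Kk fzk] fz_neq].
  suff : v (z - zbar) < 0 :> R by rewrite ltNge v_ge0.
  apply: fconvex fv => //.
    by move=> zE; apply: fz_neq; rewrite zE subrr.
  rewrite -subr_le0 -linearB -fzk linearN oppr_le0.
  by case: Kys => + _; exact.
Qed.
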